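(* Let $\alpha>0$ with $\alpha\ne1$ be fixed and $f_i=1/i^\alpha$ for $i\in[n]$. There is a constant $c$ (depending on $\alpha$) such that for all $n,B\in\mathbb{N}$ with $n\ge cB$ and \emph{any} function $h:[n]\to[B]$, letting $\tilde f_i=\sum_{j\in[n]}[h(j)=h(i)]f_j$ for $i\in[n]$, we have $$\sum_{i\in[n]}f_i\,|\tilde f_i-f_i|=\begin{cases}\Omega\!\left(\frac{n^{2-2\alpha}}{B}\right),&\alpha<1,\\ \Omega(B^{1-2\alpha}),&\alpha>1,\end{cases}$$ with implied constants depending only on $\alpha$.
   Context: $[E]$ is the indicator of event $E$. *)

(* Defs.v *)
From HB Require Import structures.
From mathcomp Require Import all_boot all_order all_algebra.
From mathcomp Require Import all_classical all_reals all_analysis.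

Set Implicit Arguments.
Unset Strict Implicit.
Unset Printing Implicit Defensive.

Import Order.TTheory GRing.Theory Num.Theory.
Local Open Scope ring_scope.

(* The index set [n] = {1, ..., n} is encoded by 'I_n = {0, ..., n-1}:
   the ordinal i stands for i.+1. *)

Definition freq (R : realType) (alpha : R) (n : nat) (i : 'I_n) : R :=
  1 / (i.+1%:R `^ alpha).

Definition estimate (R : realType) (alpha : R) (n B : nat) (h : 'I_n -> 'I_B)
    (i : 'I_n) : R :=
  \sum_(j < n) (h j == h i)%:R * freq alpha j.

(* Main.v *)
Require Import Defs.
From HB Require Import structures.
From mathcomp Require Import all_boot all_order all_algebra.
From mathcomp Require Import all_classical all_reals all_analysis.
From mathcomp Require Import ring lra.

Import Order.TTheory GRing.Theory Num.Theory.
Local Open Scope ring_scope.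

(** The total error is the sum of [f_i f_j] over ordered pairs [i <> j] that
    collide under [h]. Keep only the pairs among the first [N] indices, where
    [f >= N^-alpha]; by Cauchy-Schwarz at least [N^2 / B - N] of them collide,
    so the error is at least [N^(-2 alpha) (N^2 / B - N)]. Taking [N = n] gives
    the bound for [alpha < 1], and [N = 2 B] the one for [alpha > 1]. *)

(** Grouping the colliding pairs by bucket gives the sum of the squared loads [k b], and the loads
    sum to [#|A|]. Pairs with [i = j] are counted too. *)
Lemma sum_collisions_ge (R : realFieldType) (I T : finType) (h : I -> T)
    (A : {set I}) :
  #|A|%:R ^+ 2 / #|T|%:R <= \sum_(i in A) \sum_(j in A) (h j == h i)%:R :> R.
Proof.
pose k b : R := \sum_(j in A) (h j == b)%:R.
have sum_k : \sum_b k b = #|A|%:R.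
  rewrite exchange_big /= -sumr_const; apply: eq_bigr => j _.
  rewrite (bigD1 (h j)) //= eqxx big1 ?addr0 // => b /negPf.
  by rewrite eq_sym => ->.
have -> : \sum_(i in A) \sum_(j in A) (h j == h i)%:R = \sum_b k b ^+ 2.
  transitivity (\sum_(i in A) \sum_b (h i == b)%:R * k b).
    apply: eq_bigr => i _; rewrite [RHS](bigD1 (h i)) //= eqxx mul1r [X in _ + X]big1 ?addr0 //.
    by move=> b /negPf; rewrite eq_sym => ->; rewrite mul0r.
  rewrite exchange_big /=; apply: eq_bigr => b _.
  by rewrite -mulr_suml expr2.
(* For empty [T] the quotient is [0], as [0^-1 = 0]. *)
have [->|T0] := eqVneq (#|T|%:R : R) 0.
  by rewrite invr0 mulr0 sumr_ge0 // => b _; rewrite sqr_ge0.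
(* Cauchy-Schwarz by tangent line: [2 t k - t^2 <= k^2] at the mean load [t], and the left sides add
   up exactly to [#|A|^2 / #|T|]. *)
pose t : R := #|A|%:R / #|T|%:R.
have -> : #|A|%:R ^+ 2 / #|T|%:R = \sum_b (2 * t * k b - t ^+ 2) :> R.
  rewrite sumrB -mulr_sumr sum_k sumr_const -mulr_natr /t.
  by field.
apply: ler_sum => b _; rewrite -subr_ge0.
have -> : k b ^+ 2 - (2 * t * k b - t ^+ 2) = (k b - t) ^+ 2 by ring.
exact: sqr_ge0.
Qed.

Lemma bucket_error_ge (R : realFieldType) (I T : finType) (h : I -> T)
    (f : I -> R) (A : {set I}) (x : R) :
  0 <= x -> (forall i, 0 <= f i) -> {in A, forall i, x <= f i} ->
  x ^+ 2 * (#|A|%:R ^+ 2 / #|T|%:R - #|A|%:R) <=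
  \sum_i f i * `|\sum_j (h j == h i)%:R * f j - f i|.
Proof.
move=> x0 f0 xf.
(* The [- 1] removes the pair [(i, i)]; over [A] this costs the [#|A|] of the bound. *)
apply: (@le_trans _ _
  (\sum_(i in A) x ^+ 2 * (\sum_(j in A) (h j == h i)%:R - 1))).
  rewrite -mulr_sumr sumrB sumr_const ler_wpM2l ?sqr_ge0 //.
  by rewrite lerD2r sum_collisions_ge.
rewrite [leRHS](bigID (mem A)) /= -[leLHS]addr0 lerD //; last first.
  by rewrite sumr_ge0 // => i _; rewrite mulr_ge0.
apply: ler_sum => i iA.
(* On both sides the term [j = i] cancels what is subtracted, leaving sums of nonnegative terms over
   [j != i]. *)
rewrite (bigD1 i) //= eqxx [X in `|X - _|](bigD1 i) //= eqxx mul1r.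
rewrite !(addrC 1) !(addrC (f i)) !addrK expr2 -mulrA.
have s0 : 0 <= \sum_(j in A | j != i) (h j == h i)%:R :> R.
  by rewrite sumr_ge0.
apply: ler_pM => //; [by rewrite mulr_ge0 | exact: xf |].
apply: le_trans (ler_norm _); rewrite mulr_sumr.
rewrite [leRHS](bigID (mem A)) /= -[leLHS]addr0 lerD //; last first.
  by rewrite sumr_ge0 // => j _; rewrite mulr_ge0.
rewrite (eq_bigl (fun j => (j != i) && (j \in A))) => [|j]; last exact: andbC.
apply: ler_sum => j /andP[_ jA].
by rewrite mulrC ler_wpM2l ?xf.
Qed.

Lemma freq_error_ge (R : realType) (alpha : R) (n B N : nat)
    (h : 'I_n -> 'I_B) :
  0 <= alpha -> (0 < N <= n)%N ->
  N%:R `^ (- (2 * alpha)) * (N%:R ^+ 2 / B%:R - N%:R) <=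
  \sum_(i < n) freq alpha i * `|estimate alpha h i - freq alpha i|.
Proof.
move=> alpha0 /andP[N0 Nn].
have cardN : #|[set i : 'I_n | (i < N)%N]| = N.
  by rewrite cardsE -sum1_card -(big_ord_widen n (fun=> 1%N)) // sum1_card card_ord.
have sq : N%:R `^ (- (2 * alpha)) = (1 / N%:R `^ alpha) ^+ 2 :> R.
  by rewrite div1r -powRN -powR_mulrn ?powR_ge0 // -powRrM mulNr mulrC.
rewrite sq -{2 3}cardN -[X in _ / X%:R](card_ord B).
apply: bucket_error_ge => [|i|i].
- by rewrite divr_ge0 ?powR_ge0.
- by rewrite divr_ge0 ?powR_ge0.
(* The ordinal [i] stands for [i.+1], so [i < N] says exactly that its true index is at most [N]. *)
rewrite inE => iN; rewrite /freq !div1r lef_pV2 ?posrE ?powR_gt0 ?ltr0n //.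
by rewrite ge0_ler_powR ?nnegrE ?ler_nat.
Qed.

Theorem theoremA6 (R : realType) (alpha : R) (alpha_gt0 : 0 < alpha)
    (alpha_neq1 : alpha <> 1) :
  exists c : R, 0 < c /\
  exists C : R, 0 < C /\
  forall (n B : nat) (h : 'I_n -> 'I_B),
    (0 < B)%N -> c * B%:R <= n%:R ->
    let total := \sum_(i < n)
      freq alpha i * `|estimate alpha h i - freq alpha i| in
    (alpha < 1 -> C * (n%:R `^ (2 - 2 * alpha) / B%:R) <= total) /\
    (1 < alpha -> C * B%:R `^ (1 - 2 * alpha) <= total).
Proof.
(* [2 B <= n] makes [N = 2 B] admissible and gives [n <= (n^2 / B) / 2]. *)
exists 2; split=> //.
(* The first entry serves [N = n], the second [N = 2 B]. *)
exists (Num.min 2^-1 (2 * 2 `^ (- (2 * alpha)))); split.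
  by rewrite lt_min invr_gt0 mulr_gt0 ?powR_gt0 ?ltr0n.
move=> n B h B0 cB /=.
have B0R : 0 < B%:R :> R by rewrite ltr0n.
have Bn : (2 * B <= n)%N by rewrite -(ler_nat R) natrM.
have n0 : (0 < n)%N by apply: leq_trans Bn; rewrite muln_gt0.
split=> _.
- apply: le_trans (@freq_error_ge _ alpha n B n h (ltW alpha_gt0) _);
    last by rewrite n0 leqnn.
  rewrite powRD ?pnatr_eq0 -?lt0n ?n0 ?implybT // powR_mulrn //.
  set y := n%:R `^ (- _).
  apply: (@le_trans _ _ (2^-1 * (n%:R ^+ 2 * y / B%:R))).
    by rewrite ler_wpM2r ?ge_min ?lexx // !mulr_ge0 ?invr_ge0 ?powR_ge0 ?sqr_ge0.
  have -> : 2^-1 * (n%:R ^+ 2 * y / B%:R) = y * (2^-1 * (n%:R ^+ 2 / B%:R))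
    by ring.
  rewrite ler_wpM2l ?powR_ge0 //.
  (* Subtracting [n] then costs at most half of [n^2 / B]. *)
  suff : 2 * n%:R <= n%:R ^+ 2 / B%:R :> R by lra.
  by rewrite ler_pdivlMr // mulrAC expr2 ler_wpM2r.
- apply: le_trans (@freq_error_ge _ alpha n B (2 * B) h (ltW alpha_gt0) _);
    last by rewrite muln_gt0 B0 Bn.
  rewrite natrM powRM // powRD ?(gt_eqF B0R) ?implybT // powRr1 //.
  set y := 2 `^ (- _); set z := B%:R `^ (- _).
  (* Here [N^2 / B - N = 4 B - 2 B = 2 B]. *)
  have -> : y * z * ((2 * B%:R) ^+ 2 / B%:R - 2 * B%:R) = 2 * y * (B%:R * z)
    by field; rewrite gt_eqF.
  by rewrite ler_wpM2r ?ge_min ?lexx ?orbT // mulr_ge0 ?powR_ge0.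
Qed.
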